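(* Fix $\bar x\in E$. (a) Suppose there exist functions $w_n\in C(E)$ and constants $\lambda_n\in\mathbb{R}$, $n=0,1,2,\ldots$, such that for all $n$ and $x\in E$ $$w_n(x)=\sup_{a\in U}\Big[c_n(x,a)-\lambda_n+\int_E w_{n+1}(y)\,P_n^a(x,dy)\Big],$$ with $\sup_n\|w_n\|_{sp}<\infty$ and $w_n(\bar x)=0$ for all $n$. Then for every $x\in E$, $$\lambda:=\sup_V J_x(V)=\liminf_{n\to\infty}\frac1n\sum_{i=0}^{n-1}\lambda_i,$$ and the control $\hat V=(u_0(X_0),u_1(X_1),\ldots,u_n(X_n),\ldots)$, where each $u_n:E\to U$ is a Borel measurable selector of the maximizer in the right-hand side above, is optimal. (b) Let $\gamma\neq0$. Suppose there exist functions $\tilde w_n(\cdot,\gamma)\in C(E)$ and constants $\lambda_n^\gamma$, $n=0,1,\ldots$, such that for all $n$ and $x\in E$ $$\tilde w_n(x,\gamma)=\sup_{a\in U}\Big\{c_n(x,a)-\lambda_n^\gamma+\frac1\gamma\ln\Big[\int_E e^{\gamma\tilde w_{n+1}(y,\gamma)}P_n^a(x,dy)\Big]\Big\},$$ with $\sup_n\|\tilde w_n(\cdot,\gamma)\|_{sp}<\infty$ and $\tilde w_n(\bar x,\gamma)=0$ for all $n$. Then for every $x\in E$, $$\lambda^r(\gamma):=\sup_V J^r_x(V,\gamma)=\liminf_{n\to\infty}\frac1n\sum_{i=0}^{n-1}\lambda_i^\gamma,$$ and the control $\hat V^\gamma=(u_0^\gamma(X_0),\ldots,u_n^\gamma(X_n),\ldots)$,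 where each $u_n^\gamma$ is a Borel measurable selector of the maximizer in the right-hand side of the last equation, is optimal.
   Context: $E$ is a complete separable metric space with Borel $\sigma$-field $\mathcal{E}$; $U$ is a compact metric space of control parameters. For each $n\in\mathbb{N}_0=\{0,1,2,\ldots\}$ and $a\in U$, $P_n^a(x,dy)$ is a transition probability on $E$ (Borel measurable in $(x,a)$), and the controlled Feller property holds: for each $n$ and each bounded continuous $f$, $(x,a)\mapsto\int_E f(y)P_n^a(x,dy)$ is continuous on $E\times U$. $C(E)$ denotes bounded continuous real functions on $E$. Each $c_n:E\times U\to\mathbb{R}$ is continuous and bounded. A control is a sequence $V=(a_0,a_1,\ldots)$ of $U$-valued random variables adapted to a filtration $(F_n)$, and the controlled (nonhomogeneous) Markov process $(X_n)$ satisfies $X_0=x$ and $\mathbb{P}(X_{n+1}\in B\mid F_n)=P_n^{a_n}(X_n,B)$; $\mathbb{E}_x^V$ denotes the corresponding expectation. The functionals are $J_x(V)=\liminf_{n\to\infty}\frac1n\mathbb{E}_x^V\big[\sum_{i=0}^{n-1}c_i(X_i,a_i)\big]$ and, for $\gamma\ne0$, $J^r_x(V,\gamma)=\liminf_{n\to\infty}\frac{1}{n\gamma}\ln\mathbb{E}_x^V\big[\exp\{\gamma\sum_{i=0}^{n-1}c_i(X_i,a_i)\}\big]$. Optimal means attaining the supremum of the functional over all controls. The span seminorm is $\|v\|_{sp}=\sup_{x,x'\in E}(v(x)-v(x'))$. *)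

(* Defs.v *)
From HB Require Import structures.
From mathcomp Require Import all_boot all_order all_algebra.
From mathcomp Require Import all_classical all_reals all_analysis.
Set Implicit Arguments. Unset Strict Implicit. Unset Printing Implicit Defensive.
Import Order.TTheory GRing.Theory Num.Theory.
Import numFieldNormedType.Exports.
Local Open Scope classical_set_scope.
Local Open Scope ring_scope.

Notation borel T := (g_sigma_algebraType (@open T)).

Definition separable_space (T : topologicalType) :=
  exists D : set T, countable D /\ dense D.

Definition bcont {R : realType} {T : topologicalType} (f : T -> R) :=
  continuous f /\ exists M : R, forall x, `|f x| <= M.

Definition span_norm {R : realType} {T : Type} (v : T -> R) : \bar R :=
  ereal_sup [set ((v x - v x')%:E)%E | x in [set: T] & x' in [set: T]].

Section Controlled.
Context {R : realType} {E : completePseudoMetricType R} {U : pseudoPMetricType R}.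
Variable P : nat -> R.-pker (borel E * borel U) ~> borel E.

Definition controlled_feller := forall n (f : E -> R), bcont f ->
  continuous (fun z : E * U => Rintegral (P n z) [set: borel E] f).

(** A control V = (a_0, a_1, ...) adapted to a filtration (F_n) on some
    probability space, together with the controlled Markov process (X_n)
    started at x with P(X_{n+1} \in B | F_n) = P_n^{a_n}(X_n, B)
    (the conditional probability being expressed through its defining
    property on the sets of F_n). *)
Record control (x : E) := Control {
  cp_d : measure_display;
  cp_O : measurableType cp_d;
  cp_P : probability cp_O R;
  cp_F : nat -> set (set cp_O);
  cp_F_sigma : forall n, sigma_algebra [set: cp_O] (cp_F n);
  cp_F_sub : forall n, cp_F n `<=` measurable;
  cp_F_incr : forall n, cp_F n `<=` cp_F n.+1;
  cp_X : nat -> cp_O -> E;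
  cp_a : nat -> cp_O -> U;
  cp_X_adapted : forall n (B : set (borel E)), measurable B ->
     cp_F n (cp_X n @^-1` B);
  cp_a_adapted : forall n (B : set (borel U)), measurable B ->
     cp_F n (cp_a n @^-1` B);
  cp_X0 : forall w, cp_X 0 w = x;
  cp_trans : forall n (B : set (borel E)), measurable B ->
     forall S, cp_F n S ->
     cp_P (S `&` cp_X n.+1 @^-1` B) =
     (\int[cp_P]_(w in S) P n (cp_X n w, cp_a n w) B)%E
}.

Arguments cp_O {x} _.
Arguments cp_P {x} _.
Arguments cp_F {x} _.
Arguments cp_X {x} _ _ _.
Arguments cp_a {x} _ _ _.

Variable c : nat -> E * U -> R.

Definition cost_sum (x : E) (V : control x) (n : nat) (w : cp_O V) : R :=
  \sum_(i < n) c i (cp_X V i w, cp_a V i w).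
Arguments cost_sum {x} V n w.

Definition J (x : E) (V : control x) : \bar R :=
  limn_einf (fun n => ((n%:R^-1)%:E *
     \int[cp_P V]_w (cost_sum V n w)%:E)%E).

Definition Jr (x : E) (V : control x) (gamma : R) : \bar R :=
  limn_einf (fun n => ((n%:R * gamma)^-1 *
     ln (Rintegral (cp_P V) [set: cp_O V]
           (fun w => expR (gamma * cost_sum V n w))))%:E).

Definition supJ (x : E) : \bar R :=
  ereal_sup [set j | exists V : control x, j = J V].
Definition supJr (x : E) (gamma : R) : \bar R :=
  ereal_sup [set j | exists V : control x, j = Jr V gamma].

Definition markov_control (x : E) (u : nat -> E -> U) (V : control x) :=
  forall n w, cp_a V n w = u n (cp_X V n w).

Definition rhs (w : nat -> E -> R) (lam : nat -> R) n x a : \bar R :=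
  ((c n (x, a) - lam n)%:E + \int[P n (x, a)]_y (w n.+1 y)%:E)%E.

Definition rhs_r (gamma : R) (w : nat -> E -> R) (lam : nat -> R) n x a : \bar R :=
  (c n (x, a) - lam n + gamma^-1 *
     ln (Rintegral (P n (x, a)) [set: borel E] (fun y => expR (gamma * w n.+1 y))))%:E.

End Controlled.

(* Main.v *)
(** The certainty equivalent [C f = g^-1 ln E (exp (g f))], with [C f = E f] at
    [g = 0], is monotone, commutes with adding constants and has the tower
    property along the controlled process.  Telescoping the Bellman equation
    through it bounds [C] of the total cost by the sum of the [lam_i] up to a
    constant independent of the horizon, with equality up to a constant as soon
    as the action used at time [n] is [2^-n]-optimal.  Such actions are chosen
    measurably from a dense sequence of [U], and the controlled process itself
    comes from the Ionescu-Tulcea construction. *)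
Require Import Defs.
From HB Require Import structures.
From mathcomp Require Import all_boot all_order all_algebra.
From mathcomp Require Import all_classical all_reals all_analysis.
From mathcomp Require Import measurable_realfun lra.
Set Implicit Arguments. Unset Strict Implicit. Unset Printing Implicit Defensive.
Import Order.TTheory GRing.Theory Num.Theory.
Import numFieldNormedType.Exports.
Local Open Scope classical_set_scope.
Local Open Scope ring_scope.
Local Open Scope ereal_scope.

(** The value formula is asserted before any maximizing selector is given, so the lower bound has to
    produce its own control; action errors that are summable in [n] cost only a constant, which
    division by the horizon removes. The same division absorbs [w]: the span bound and the
    normalization at [xbar] give one bound [M] on all [w n]. The defining property of a controlled
    process speaks only of the events of [cp_F], whereas telescoping integrates products of a weight
    known at time [n] with a function of the next state; the passage compares two measures on a
    product space that agree on rectangles. Measurability on [borel E * borel U] refers to a product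
    of two Borel sigma-algebras; continuous functions on [E * U] are measurable there by second
    countability, which comes from separability of [E] and compactness of [U]. The chain is built
    over an arbitrary measurable type: its laws are indexed by the starting time, so continuity at
    the empty set follows from choosing a path step by step, without topology. *)

Lemma integrable_bounded d (T : measurableType d) (R : realType)
    (m : {measure set T -> \bar R}) (f : T -> R) (M : R) :
  m setT = 1 -> measurable_fun [set: T] f -> (forall t, (`|f t| <= M)%R) ->
  m.-integrable [set: T] (EFin \o f).
Proof.
move=> m1 mf fM; apply: measurable_bounded_integrable => //.
  by rewrite m1 ltry.
exists M; split; first exact: num_real.
by move=> y /ltW My t _; exact: le_trans (fM t) My.
Qed.

(** * Ionescu-Tulcea construction for Markov chains *)

Section kpull.
Context d1 d2 d3 (X : measurableType d1) (Y : measurableType d2)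
  (Z : measurableType d3) (R : realType).
Variables (f : X -> Y) (k : R.-pker Y ~> Z).

Definition kpull (mf : measurable_fun [set: X] f) (x : X) :
  {measure set Z -> \bar R} := k (f x).

Hypothesis mf : measurable_fun [set: X] f.

Let measurable_kpull A : measurable A -> measurable_fun [set: X] (kpull mf ^~ A).
Proof. by move=> mA; apply: (measurableT_comp (measurable_kernel k _ mA)). Qed.

HB.instance Definition _ := isKernel.Build _ _ _ _ _ (kpull mf) measurable_kpull.

Let kpull_prob x : kpull mf x [set: Z] = 1.
Proof. exact: prob_kernel. Qed.

HB.instance Definition _ :=
  Kernel_isProbability.Build _ _ _ _ _ (kpull mf) kpull_prob.
End kpull.

Section kconst.
Context d1 d2 (X : measurableType d1) (Y : measurableType d2) (R : realType).
Variable m : probability Y R.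

Definition kconst (_ : X) : {measure set Y -> \bar R} := m.

Let measurable_kconst A : measurable A -> measurable_fun [set: X] (kconst ^~ A).
Proof. by move=> _; exact: measurable_cst. Qed.

HB.instance Definition _ := isKernel.Build _ _ _ _ _ kconst measurable_kconst.

Let kconst_prob x : kconst x [set: Y] = 1.
Proof. exact: probability_setT. Qed.

HB.instance Definition _ :=
  Kernel_isProbability.Build _ _ _ _ _ kconst kconst_prob.
End kconst.
Arguments kconst {d1 d2} X {Y R} m _.

Section kbind.
Context d1 d2 d3 (X : measurableType d1) (Y : measurableType d2)
  (Z : measurableType d3) (R : realType).
Variables (l : R.-pker X ~> Y) (k : R.-pker (X * Y)%type ~> Z).

Definition kbind : X -> {measure set Z -> \bar R} := mkcomp l k.

Let measurable_kbind A : measurable A -> measurable_fun [set: X] (kbind ^~ A).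
Proof. by move=> mA; exact: KCOMP_FINITE_KERNEL.measurable_fun_kcomp_finite. Qed.

HB.instance Definition _ := isKernel.Build _ _ _ _ _ kbind measurable_kbind.

Let kbind_prob x : kbind x [set: Z] = 1.
Proof.
rewrite /kbind /= /kcomp.
under eq_integral do rewrite prob_kernel.
by rewrite integral_cst// mul1e prob_kernel.
Qed.

HB.instance Definition _ :=
  Kernel_isProbability.Build _ _ _ _ _ kbind kbind_prob.

Lemma integral_kbind x f : (forall z, 0 <= f z) -> measurable_fun [set: Z] f ->
  \int[kbind x]_z f z = \int[l x]_y \int[k (x, y)]_z f z.
Proof. exact: integral_kcomp. Qed.
End kbind.

(** * Paths, their coordinates and the sigma-algebras of the past *)

Section path_space.
Context d (T : measurableType d).

Definition coordinate_sets : set (set (nat -> T)) :=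
  [set A | exists n B, measurable B /\ A = [set w | B (w n)]].

Definition path_space := g_sigma_algebraType coordinate_sets.

Lemma measurable_coordinate n : measurable_fun [set: path_space] (fun w => w n).
Proof.
move=> _ B mB; rewrite setTI; apply: sub_sigma_algebra.
by exists n, B.
Qed.

Lemma measurable_fun_path d' (S : measurableType d') (f : S -> path_space) :
  (forall n, measurable_fun [set: S] (fun s => f s n)) ->
  measurable_fun [set: S] f.
Proof.
move=> mf; apply: (@measurability _ _ S path_space setT f coordinate_sets) => //.
by move=> _ [_ [n [B [mB ->]]] <-]; exact: mf.
Qed.

Definition upd n (w : path_space) (y : T) : path_space :=
  fun i => if i == n then y else w i.

Lemma measurable_upd n : measurable_fun [set: path_space * T]
  (fun z => upd n z.1 z.2).
Proof.
apply: measurable_fun_path => i; rewrite /upd; case: (i == n).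
  exact: measurable_snd.
exact: (measurableT_comp (measurable_coordinate i) measurable_fst).
Qed.

Lemma measurable_updr n w : measurable_fun [set: T] (upd n w).
Proof.
apply: measurable_fun_path => i; rewrite /upd; case: (i == n).
  exact: measurable_id.
exact: measurable_cst.
Qed.

(** The starting point is not stored in the path: coordinate [m] holds the state of time [m.+1].
    Hence the state at time 0 equals [x] on every path, and the state at time [n] depends on the
    first [n] coordinates only. *)
Definition state (x : T) n (w : path_space) : T := if n is m.+1 then w m else x.

Lemma measurable_state x n : measurable_fun [set: path_space] (state x n).
Proof. by case: n => [|n]; [exact: measurable_cst|exact: measurable_coordinate]. Qed.

Definition trunc n (w : path_space) : path_space :=
  fun i => if (i < n)%N then w i else point.

Lemma measurable_trunc n : measurable_fun [set: path_space] (trunc n).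
Proof.
apply: measurable_fun_path => i; rewrite /trunc; case: (i < n)%N.
  exact: measurable_coordinate.
exact: measurable_cst.
Qed.

Lemma trunc_trunc m n w : (m <= n)%N -> trunc m (trunc n w) = trunc m w.
Proof.
move=> mn; apply/funext => i; rewrite /trunc; case: ifPn => // im.
by rewrite (leq_trans im mn).
Qed.

Lemma trunc_upd m n w y : (m <= n)%N -> trunc m (upd n w y) = trunc m w.
Proof.
move=> mn; apply/funext => i; rewrite /trunc /upd; case: ifPn => // im.
by rewrite ltn_eqF// (leq_trans im mn).
Qed.

Lemma state_trunc x n w : state x n (trunc n w) = state x n w.
Proof. by case: n => //= n; rewrite /trunc ltnSn. Qed.

(** The sigma-algebra generated by the first [n] coordinates, expressed through invariance under
    truncation, so that membership can be checked path by path. *)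
Definition past n : set (set path_space) :=
  [set A | measurable A /\ forall w, A (trunc n w) <-> A w].

Lemma sigma_algebra_past n : sigma_algebra setT (past n).
Proof.
split; first by split => //; exact: measurable0.
  move=> A [mA hA]; rewrite setTD; split; first exact: measurableC.
  by move=> w; split => + /hA.
move=> F hF; split; first by apply: bigcupT_measurable => i; case: (hF i).
by move=> w; split => -[i _ /(hF i).2 ?]; exists i.
Qed.

Lemma past_le m n : (m <= n)%N -> past m `<=` past n.
Proof.
move=> mn A [mA hA]; split=> // w; rewrite -(hA w) -(hA (trunc n w)).
by rewrite trunc_trunc.
Qed.

Lemma past_upd m n A w y : past m A -> (m <= n)%N -> A (upd n w y) <-> A w.
Proof.
by move=> [_ hA] mn; rewrite -(hA w) -(hA (upd n w y)) trunc_upd.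
Qed.

Lemma past_state x n B : measurable B -> past n (state x n @^-1` B).
Proof.
move=> mB; split; last by move=> w; rewrite /preimage/= state_trunc.
by rewrite -[X in measurable X]setTI; exact: measurable_state.
Qed.

Lemma past_preimage_trunc n A : measurable A -> past n (trunc n @^-1` A).
Proof.
move=> mA; split; first by rewrite -[X in measurable X]setTI; exact: measurable_trunc.
by move=> w; rewrite /preimage/= trunc_trunc.
Qed.

End path_space.

(** * Finite-horizon laws and their common value on cylinders *)

Section chain_kernels.
Context d (T : measurableType d) (R : realType).
Variables (Q : nat -> R.-pker T ~> T) (x : T).
Local Notation W := (path_space T).

(** The step at time [m] draws the next state, writes it into coordinate [m], and lets [k] continue
    from the updated path. *)
Definition kstep m (k : R.-pker W ~> W) : R.-pker W ~> W :=
  kbind (kpull (Q m) (measurable_state x m)) (kpull k (@measurable_upd _ T m)).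

Fixpoint kiter (j m : nat) : R.-pker W ~> W :=
  if j is i.+1 then kstep m (kiter i m.+1) else kdirac (@measurable_id _ W setT).

Lemma kiterS j m w A : kiter j.+1 m w A =
  \int[Q m (state x m w)]_y kiter j m.+1 (upd m w y) A.
Proof. by []. Qed.

Lemma integral_kiterS j m w f : (forall v, 0 <= f v) ->
  measurable_fun [set: W] f ->
  \int[kiter j.+1 m w]_v f v =
  \int[Q m (state x m w)]_y \int[kiter j m.+1 (upd m w y)]_v f v.
Proof. by move=> f0 mf; rewrite /= /kstep integral_kbind. Qed.

(** Steps from time [m] on only write coordinates of index at least [m], so an event decided by the
    first [N <= m] of them is left untouched. *)
Lemma kiter_past N A : past N A -> forall j m w, (N <= m)%N ->
  kiter j m w A = \d_w A.
Proof.
move=> pA; elim=> [//|j IH] m w Nm; rewrite kiterS.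
have -> : (fun y => kiter j m.+1 (upd m w y) A) = cst (\d_w A).
  apply/funext => y; rewrite IH ?(leqW Nm)//= !diracE.
  have -> // : (upd m w y \in A) = (w \in A).
  by apply/idP/idP; rewrite !inE => /(past_upd w y pA Nm).
by rewrite integral_cst// prob_kernel mule1.
Qed.

Lemma kiter_stable N A : past N A -> forall j j' m w,
  (N <= m + j)%N -> (N <= m + j')%N -> kiter j m w A = kiter j' m w A.
Proof.
move=> pA; elim=> [|j IH] [//|j'] m w.
- by rewrite addn0 => Nm _; rewrite !(kiter_past pA).
- by rewrite addn0 => _ Nm; rewrite !(kiter_past pA).
move=> Nm Nm'; rewrite !kiterS; apply: eq_integral => y _.
by apply: IH; rewrite addSnnS.
Qed.

Definition cylinder : set (set W) := [set A | exists N, past N A].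

(* Number of steps from time [m] after which the law of a cylinder is settled. *)
Definition horizon m (A : set W) : nat :=
  xget 0%N [set j | exists2 N, past N A & (N <= m + j)%N].

Definition klim m (w : W) (A : set W) : \bar R := kiter (horizon m A) m w A.

Lemma klimE N A j m w : past N A -> (N <= m + j)%N ->
  klim m w A = kiter j m w A.
Proof.
move=> pA Nmj; rewrite /klim /horizon.
case: xgetP => [i _ [N' pA' N'mi]|/(_ j) /=]; last by case; exists N.
transitivity (kiter (maxn i j) m w A).
  apply: (kiter_stable pA') => //; apply: (leq_trans N'mi).
  by rewrite leq_add2l leq_maxl.
apply: (kiter_stable pA) => //; apply: (leq_trans Nmj).
by rewrite leq_add2l leq_maxr.
Qed.

Lemma klimS m w A : cylinder A ->
  klim m w A = \int[Q m (state x m w)]_y klim m.+1 (upd m w y) A.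
Proof.
move=> [N pA]; rewrite (@klimE N _ N.+1 m w pA) ?kiterS; last first.
  by rewrite addnS leqW// leq_addl.
by apply: eq_integral => y _; rewrite (@klimE N _ N)// leq_addl.
Qed.

Lemma klim_past N A m w : past N A -> (N <= m)%N -> klim m w A = \d_w A.
Proof. by move=> pA Nm; rewrite (@klimE N _ 0)// addn0. Qed.

Lemma measurable_klim m A : cylinder A -> measurable_fun [set: W] (klim m ^~ A).
Proof.
move=> [N pA]; have -> : klim m ^~ A = kiter N m ^~ A.
  by apply/funext => w; rewrite (@klimE N _ N)// leq_addl.
by apply: measurable_kernel; case: pA.
Qed.

Lemma klim_ge0 m w A : 0 <= klim m w A.
Proof. exact: measure_ge0. Qed.

Lemma cylinder_past2 A B : cylinder A -> cylinder B ->
  exists N, past N A /\ past N B.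
Proof.
move=> [N pA] [N' pB]; exists (maxn N N'); split.
- by apply: past_le pA; exact: leq_maxl.
- by apply: past_le pB; exact: leq_maxr.
Qed.

Lemma klim_le1 m w A : cylinder A -> klim m w A <= 1.
Proof.
move=> [N pA]; rewrite (@klimE N _ N) ?leq_addl//.
rewrite -[leRHS](@prob_kernel _ _ _ _ _ (kiter N m) w).
by apply: le_measure; rewrite ?inE//; case: pA.
Qed.

Lemma le_klim m w A B : cylinder A -> cylinder B -> A `<=` B ->
  klim m w A <= klim m w B.
Proof.
move=> cA cB AB; have [N [pA pB]] := cylinder_past2 cA cB.
rewrite !(@klimE N _ N) ?leq_addl//.
by apply: le_measure; rewrite ?inE//; [case: pA|case: pB].
Qed.

Lemma klimU m w A B : cylinder A -> cylinder B -> A `&` B = set0 ->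
  klim m w (A `|` B) = klim m w A + klim m w B.
Proof.
move=> cA cB AB; have [N [pA pB]] := cylinder_past2 cA cB.
have pU : past N (A `|` B).
  case: pA => mA hA; case: pB => mB hB; split; first exact: measurableU.
  by move=> v; rewrite /setU/= hA hB.
rewrite !(@klimE N _ N) ?leq_addl// measureU//.
- by case: pA.
- by case: pB.
Qed.

Let bad (D : nat -> set W) m w := ~ (klim m w (D k) @[k --> \oo] --> 0).

(** Dominated convergence read backwards: if every continuation had masses tending to 0, then so
    would their average over the next state, the masses being at most 1. *)
Let bad_step D m w : (forall k, cylinder (D k)) -> bad D m w ->
  exists y, bad D m.+1 (upd m w y).
Proof.
move=> cD bad_m; apply/existsNP => good_m1; apply: bad_m.
under eq_fun do rewrite klimS//.
rewrite -(integral0 (Q m (state x m w)) setT).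
apply: (@dominated_cvg _ _ _ _ _ _ _ _ (cst 1)) => //.
- move=> k; apply: (measurableT_comp (measurable_klim m.+1 (cD k))).
  exact: measurable_updr.
- by move=> y _; exact: contrapT (good_m1 y).
- apply: (@integrable_bounded _ _ _ _ (cst 1%R) 1%R) => [||y].
  + exact: prob_kernel.
  + exact: measurable_cst.
  + by rewrite normr1.
- by move=> k y _; rewrite gee0_abs ?klim_ge0// klim_le1.
Qed.

(* If the masses stayed bounded away from zero, a path lying in all the
   [D k] could be chosen coordinate by coordinate. *)
Lemma klim_cvg0 D w : (forall k, cylinder (D k)) ->
  (forall k l, (k <= l)%N -> D l `<=` D k) -> \bigcap_k D k = set0 ->
  klim 0 w (D k) @[k --> \oo] --> 0.
Proof.
move=> cD niD D0; apply: contrapT => bad0.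
have /choice[f fP] (p : nat * W) : exists y,
    bad D p.1 p.2 -> bad D p.1.+1 (upd p.1 p.2 y).
  have [/(bad_step cD)[y hy]|nb] := pselect (bad D p.1 p.2); first by exists y.
  by exists point.
(* [s n.+1] differs from [s n] in coordinate [n] alone, so the diagonal path [v] shares its first
   [n] coordinates with [s n]. *)
pose s := fix s n := if n is m.+1 then upd m (s m) (f (m, s m)) else w.
have bad_s n : bad D n (s n) by elim: n => [//|n IH]; exact: (fP (n, s n)).
pose v : W := fun n => s n.+1 n.
have vs n : trunc n v = trunc n (s n).
  apply/funext => i; rewrite /trunc; case: ifPn => // {}i_n.
  elim: n i_n => // n IH; rewrite ltnS leq_eqVlt => /predU1P[->//|i_n].
  by rewrite IH//= /upd (ltn_eqF i_n).
suff : (\bigcap_k D k) v by rewrite D0.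
move=> k _; have [N pD] := cD k.
(* At time [N] the event [D k] is already decided. If [s N] were outside it, its mass would be 0,
   and by monotonicity so would that of every later [D l], against [bad_s N]. *)
apply/(pD.2 v); rewrite vs; apply/(pD.2 (s N)); apply: contrapT => sND.
apply: (bad_s N); apply: cvg_near_cst; exists k => // l /= kl.
apply/eqP; rewrite eq_le klim_ge0 andbT.
rewrite (le_trans (le_klim _ _ (cD l) (cD k) (niD _ _ kl)))//.
by rewrite (klim_past _ pD)// diracE memNset.
Qed.

End chain_kernels.

(** * The algebra of cylinders *)

Section cylinder_algebra.
Context d (T : measurableType d).

(** A separate name for the space of paths, so that it can carry the algebra of cylinders while
    [path_space] carries a sigma-algebra. *)
Definition cylinder_space := nat -> T.

HB.instance Definition _ := Pointed.on cylinder_space.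

Let cylinder0 : @cylinder _ T set0.
Proof. by exists 0%N; split=> //; exact: measurable0. Qed.

Let cylinderU : setU_closed (@cylinder _ T).
Proof.
move=> A B cA cB; have [N [[mA hA] [mB hB]]] := cylinder_past2 cA cB.
exists N; split; first exact: measurableU.
by move=> w; rewrite /setU/= hA hB.
Qed.

Let cylinderC : setC_closed (@cylinder _ T).
Proof.
move=> A [N [mA hA]]; exists N; split; first exact: measurableC.
by move=> w; rewrite /setC/= hA.
Qed.

HB.instance Definition _ := isAlgebraOfSets.Build default_measure_display
  cylinder_space cylinder0 cylinderU cylinderC.

End cylinder_algebra.

Lemma past_next d (T : measurableType d) n (S : set (path_space T)) B :
  past n S -> measurable B -> past n.+1 (S `&` [set v | B (v n)]).
Proof.
move=> pS mB; have [mS hS] := past_le (leqnSn n) pS.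
split; first by apply: measurableI => //; case: (past_state point n.+1 mB).
by move=> v; rewrite /setI/= hS /trunc ltnSn.
Qed.

(** * Extension to a probability on paths and its Markov property *)

Section ionescu_tulcea.
Context d (T : measurableType d) (R : realType).
Variables (Q : nat -> R.-pker T ~> T) (x : T).
Local Notation C := (cylinder_space T).

(** The path [cst x] is a placeholder: on a cylinder, every coordinate that matters is overwritten
    by the steps from time 0. *)
Definition premeasure (A : set C) : \bar R := klim Q x 0 (cst x) A.

Let premeasure0 : premeasure set0 = 0.
Proof. exact: measure0. Qed.

Let premeasure_ge0 A : 0 <= premeasure A.
Proof. exact: klim_ge0. Qed.

Let premeasure_additive : measure_function.semi_additive premeasure.
Proof.
apply/(additive2P premeasure0) => A B cA cB AB.
exact: klimU.
Qed.

HB.instance Definition _ :=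
  isContent.Build _ _ _ premeasure premeasure_ge0 premeasure_additive.

Let premeasure_fin A : measurable A -> premeasure A \is a fin_num.
Proof.
move=> cA; rewrite ge0_fin_numE ?premeasure_ge0//.
by rewrite (le_lt_trans (klim_le1 _ _ _ _ cA))// ltry.
Qed.

(** Additivity turns the partial sums into the mass of the union minus that of the remainder [D k];
    the remainders decrease to the empty set, so [klim_cvg0] applies. *)
Let premeasure_sigma_additive : semi_sigma_additive premeasure.
Proof.
move=> F cF tF cUF.
pose B k := \big[setU/set0]_(0 <= i < k) F i.
pose D k := (\bigcup_i F i) `\` B k.
have cB k : measurable (B k) by exact: bigsetU_measurable.
have cD k : measurable (D k) by exact: measurableD.
have BU k : B k `<=` \bigcup_i F i.
  by rewrite /B big_mkord -bigcup_mkord => w [i _ Fiw]; exists i.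
have -> : (fun k => \sum_(0 <= i < k) premeasure (F i)) =
          (fun k => premeasure (\bigcup_i F i) - premeasure (D k)).
  apply/funext => k; rewrite -(setDUK (BU k)) -/(D k).
  rewrite [X in X - _](_ : _ = premeasure (B k) + premeasure (D k)); last first.
    apply: klimU; [exact: cB|exact: cD|].
    by rewrite /D setDE setICA setICr setI0.
  rewrite addeK ?premeasure_fin// /B !big_mkord.
  rewrite measure_semi_additive_ord_I//.
    exact: sub_trivIset tF.
  by have := cB k; rewrite /B big_mkord.
rewrite -[X in _ --> X]sube0; apply: cvgeB => //.
- by rewrite fin_num_adde_defl.
- exact: cvg_cst.
apply: klim_cvg0; first exact: cD.
- move=> k l kl; apply: setDS; rewrite /B !big_mkord.
  exact: subset_bigsetU.
- apply/seteqP; split=> // w wD; have [[i _ Fiw] _] := wD 0%N I.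
  have [_] := wD i.+1 I; apply; rewrite /B big_mkord -bigcup_mkord.
  by exists i => //=.
Qed.

HB.instance Definition _ :=
  Content_isMeasure.Build _ _ _ premeasure premeasure_sigma_additive.

Local Notation I := (g_sigma_algebraType (@measurable _ C)).

Definition chain_law : set I -> \bar R := measure_extension premeasure.

HB.instance Definition _ := Measure.on chain_law.

Lemma chain_lawE (A : set (path_space T)) :
  cylinder A -> chain_law A = klim Q x 0 (cst x) A.
Proof. by move=> cA; exact: measurable_mu_extE. Qed.

Lemma cylinderT : @cylinder _ T setT.
Proof. by exists 0%N; split => //; exact: measurableT. Qed.

Let chain_lawT : chain_law setT = 1.
Proof.
rewrite chain_lawE; last exact: cylinderT.
have p0 : past 0 [set: path_space T] by split => //; exact: measurableT.
by rewrite (klim_past _ _ _ p0)// diracT.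
Qed.

HB.instance Definition _ := Measure_isProbability.Build _ _ _ chain_law chain_lawT.

Lemma measurable_trunc_chain n :
  measurable_fun [set: I] (@trunc _ T n : I -> path_space T).
Proof.
move=> _ A mA; rewrite setTI; apply: sub_sigma_algebra.
by exists n; exact: past_preimage_trunc.
Qed.

(** [chain_law] and the [n]-step law agree on cylinders, hence have the same image under [trunc n],
    and [f] factors through that map. Passing to images also reconciles the two sigma-algebras on
    paths. *)
Lemma integral_chain_law n (f : path_space T -> \bar R) :
  (forall w, 0 <= f w) -> measurable_fun [set: path_space T] f ->
  (forall w, f (trunc n w) = f w) ->
  \int[chain_law]_w f w = \int[kiter Q x n 0 (cst x)]_w f w.
Proof.
move=> f0 mf ft.
have mT := @measurable_trunc _ T n; have mC := measurable_trunc_chain n.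
transitivity (\int[pushforward chain_law (@trunc _ T n)]_w f w).
  rewrite ge0_integral_pushforward//.
  by rewrite preimage_setT; apply: eq_integral => w _ /=; rewrite ft.
transitivity (\int[pushforward (kiter Q x n 0 (cst x)) (@trunc _ T n)]_w f w).
  apply: eq_measure_integral => // A mA _.
  have pA := past_preimage_trunc n mA.
  apply: (etrans (chain_lawE (ex_intro _ n pA))).
  by rewrite (klimE _ _ (j := n) _ pA).
rewrite ge0_integral_pushforward//.
by rewrite preimage_setT; apply: eq_integral => w _ /=; rewrite ft.
Qed.

(** An arbitrary starting time [m] is allowed because the induction on [j] moves one step from [m]
    to [m.+1] while the observed time [m + j] stays fixed. *)
Lemma klim_transition j m w (S : set (path_space T)) B :
  past (m + j) S -> measurable B ->
  klim Q x m w (S `&` [set v | B (v (m + j)%N)]) =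
  \int[kiter Q x j m w]_(v in S) Q (m + j) (state x (m + j) v) B.
Proof.
move=> pS mB; set n := (m + j)%N in pS *.
have mS : measurable S by case: pS.
have mQ : measurable_fun [set: path_space T] (fun v => Q n (state x n v) B).
  exact: (measurableT_comp (measurable_kernel (Q n) _ mB) (measurable_state x n)).
have pSB : past n.+1 (S `&` [set v | B (v n)]).
  exact: past_next.
rewrite integral_mkcond (klimE _ _ (j := j.+1) _ pSB) ?addnS//.
have mf : measurable_fun [set: path_space T]
    ((fun v => Q n (state x n v) B) \_ S).
  by apply: (iffLR (measurable_restrictT _ mS)); exact: measurable_funTS.
have f0 v : 0 <= ((fun v => Q n (state x n v) B) \_ S) v.
  by rewrite patchE; case: ifPn.
rewrite {}/n in pS mQ pSB mf f0 *.
elim: j m w pS mQ pSB mf f0 => [|j IH] m w; rewrite ?addn0.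
  move=> pS mQ pSB mf f0; rewrite integral_dirac// diracT mul1e patchE kiterS.
  (* [S] is decided by [w] before the step, whereas [B] tests exactly the coordinate that the step
     writes, so the indicator splits. *)
  transitivity (\int[Q m (state x m w)]_y (\d_w S * \d_y B : \bar R)).
    apply: eq_integral => y _ /=.
    rewrite /kdirac !diracE -EFinM -natrM mulnb; congr (_%:R%:E).
    have -> // : (upd m w y \in S `&` [set v | B (v m)]) =
                 (w \in S) && (y \in B).
    rewrite in_setI; congr andb.
      by apply/idP/idP; rewrite !inE => /(past_upd w y pS (leqnn _)).
    by apply/idP/idP; rewrite !inE /= /upd eqxx.
  rewrite ge0_integralZl//; last by exact: measurable_fun_dirac.
  have -> : \int[Q m (state x m w)]_y \d_y B = Q m (state x m w) B.
    by rewrite [LHS](integral_indic _ measurableT mB) setIT.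
  by rewrite diracE; case: (w \in S); rewrite ?mul1e ?mul0e.
rewrite -[(m + j.+1)%N]addSnnS => pS mQ pSB mf f0.
rewrite integral_kiterS// kiterS; apply: eq_integral => y _.
exact: IH.
Qed.

Lemma chain_transition n (S : set (path_space T)) B : past n S -> measurable B ->
  chain_law (S `&` [set v | B (v n)]) =
  \int[chain_law]_(v in S) Q n (state x n v) B.
Proof.
move=> pS mB; have mS : measurable S by case: pS.
rewrite chain_lawE; last first.
  by exists n.+1; exact: past_next.
have := @klim_transition n 0%N (cst x) S B; rewrite add0n => -> //.
rewrite integral_mkcond [RHS]integral_mkcond (@integral_chain_law n)//.
- by move=> w; rewrite patchE; case: ifPn.
- apply: (iffLR (measurable_restrictT _ mS)); apply: measurable_funTS.
  exact: (measurableT_comp (measurable_kernel (Q n) _ mB) (measurable_state x n)).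
- move=> w; rewrite !patchE state_trunc.
  have -> // : (trunc n w \in S) = (w \in S).
  by apply/idP/idP; rewrite !inE => /(pS.2 w).
Qed.

End ionescu_tulcea.

(** * Controlled processes *)

#[local] Arguments cp_F {R E U P x} c _ _.
#[local] Arguments cp_X {R E U P x} c _ _.
#[local] Arguments cp_a {R E U P x} c _ _.

Section markov_control_exists.
Context (R : realType) (E : completePseudoMetricType R) (U : pseudoPMetricType R).
Variables (P : nat -> R.-pker (borel E * borel U) ~> borel E) (x : E).
Variable u : nat -> E -> U.
Hypothesis mu : forall n,
  measurable_fun [set: borel E] (u n : borel E -> borel U).

Let mgraph n : measurable_fun [set: borel E]
  (fun y : borel E => (y, u n y : borel U) : borel E * borel U).
Proof. by apply: measurable_fun_pair => //; exact: mu. Qed.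

Let Q n : R.-pker (borel E) ~> (borel E) := kpull (P n) (mgraph n).

(** Feedback through [u] turns the controlled kernels into the ordinary nonhomogeneous kernels
    [Q n]; the control is the chain with these kernels, filtered by [past], with actions read off
    the state. *)
Lemma markov_control_exists : exists V : control P x, markov_control u V.
Proof.
have st n (B : set (borel E)) : measurable B ->
    past n (state (x : borel E) n @^-1` B) by exact: past_state.
unshelve eexists (@Control R E U P x _ _ (chain_law Q (x : borel E))
  (fun n => @past _ (borel E) n) _ _ _
  (fun n w => state (x : borel E) n w)
  (fun n w => u n (state (x : borel E) n w)) _ _ _ _).
- by move=> n; exact: sigma_algebra_past.
- by move=> n A pA; apply: sub_sigma_algebra; exists n.
- by move=> n; exact: past_le.
- exact: st.
- move=> n B mB; apply: (st n (u n @^-1` B)).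
  by rewrite -[X in measurable X]setTI; exact: mu.
- by [].
- by move=> n B mB S pS; exact: chain_transition.
- by move=> n w.
Qed.

End markov_control_exists.

(** * Integration against the conditional law of the next state *)

Section tower.
Context (R : realType) (E : completePseudoMetricType R) (U : pseudoPMetricType R).
Variables (P : nat -> R.-pker (borel E * borel U) ~> borel E) (x : E).
Variables (V : control P x) (n : nat).

Local Notation O := (cp_O V).
Local Notation G := (g_sigma_algebraType (cp_F V n)).

Lemma measurable_history (A : set O) :
  (measurable : set (set G)) A = cp_F V n A.
Proof. by congr (_ A); exact: sigma_algebra_id (cp_F_sigma V n). Qed.

Lemma measurable_fun_history d (T : measurableType d) (f : O -> T) :
  (forall B, measurable B -> cp_F V n (f @^-1` B)) ->
  measurable_fun [set: G] (f : G -> T).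
Proof. by move=> hf _ B mB; rewrite setTI measurable_history; exact: hf. Qed.

Lemma measurable_fun_of_history d (T : measurableType d) (f : O -> T) :
  measurable_fun [set: G] (f : G -> T) -> measurable_fun [set: O] f.
Proof.
move=> mf _ B mB; rewrite setTI; apply: (@cp_F_sub _ _ _ _ _ V n).
by rewrite -measurable_history -[X in measurable X]setTI; exact: mf.
Qed.

Lemma measurable_state_action : measurable_fun [set: G]
  ((fun w => (cp_X V n w : borel E, cp_a V n w : borel U)) : G -> _).
Proof.
apply: measurable_fun_pair; apply: measurable_fun_history.
- exact: cp_X_adapted.
- exact: cp_a_adapted.
Qed.

Lemma measurable_next :
  measurable_fun [set: O] (fun w => cp_X V n.+1 w : borel E).
Proof.
move=> _ B mB; rewrite setTI; apply: (@cp_F_sub _ _ _ _ _ V n.+1).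
exact: cp_X_adapted.
Qed.

Let mpair : measurable_fun [set: O]
  (fun w => (w, cp_X V n.+1 w) : G * borel E).
Proof.
apply: measurable_fun_pair; last exact: measurable_next.
exact: (@measurable_fun_of_history _ G id (@measurable_id _ G setT)).
Qed.

Let mid : measurable_fun [set: O * borel E]
  (fun z => (z.1 : G, z.2) : G * borel E).
Proof.
apply: measurable_fun_pair; last exact: measurable_snd.
exact: (measurableT_comp
  (@measurable_fun_of_history _ G id (@measurable_id _ G setT)) measurable_fst).
Qed.

Let msa := measurable_fun_of_history measurable_state_action.

Let kjoint : R.-pker O ~> (G * borel E)%type :=
  kbind (kpull (P n) msa) (kdirac mid).

(** The law on pairs obtained by drawing the sample point from [cp_P V] and then the next state from
    [P n]. The source of the constant kernel is a dummy, hence [point]. *)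
Let joint : {measure set (G * borel E)%type -> \bar R} :=
  kbind (kconst O (cp_P V)) (kpull kjoint measurable_snd) point.

Let joint_rect (S : set G) (B : set (borel E)) : measurable S -> measurable B ->
  pushforward (cp_P V) (fun w => (w, cp_X V n.+1 w) : G * borel E) (S `*` B) =
  joint (S `*` B).
Proof.
move=> mS mB; have FS : cp_F V n S by rewrite -measurable_history.
transitivity (cp_P V (S `&` cp_X V n.+1 @^-1` B)); first by [].
rewrite cp_trans// integral_mkcond; apply: eq_integral => w _.
rewrite patchE /kpull /=.
transitivity (\int[P n (cp_X V n w, cp_a V n w)]_y (\d_w S * \d_y B : \bar R)).
  rewrite ge0_integralZl//; last exact: measurable_fun_dirac.
  have -> : \int[P n (cp_X V n w, cp_a V n w)]_y \d_y B =
      P n (cp_X V n w, cp_a V n w) B.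
    by rewrite [LHS](integral_indic _ measurableT mB) setIT.
  by rewrite diracE; case: (w \in S); rewrite ?mul1e ?mul0e.
apply: eq_integral => y _ /=.
rewrite /kdirac !diracE -EFinM -natrM mulnb; congr (_%:R%:E).
by rewrite in_setX.
Qed.

(** The image of [cp_P V] under pairing with the next state coincides with [joint]: [cp_trans] gives
    this on rectangles, with first factor in [cp_F V n]. Integrating a product against both measures
    yields the two sides. *)
Lemma integral_next (Z : O -> R) (g : borel E -> R) :
  (forall w, 0 <= Z w)%R -> (forall y, 0 <= g y)%R ->
  measurable_fun [set: G] (Z : G -> R) -> measurable_fun [set: borel E] g ->
  \int[cp_P V]_w (Z w * g (cp_X V n.+1 w))%:E =
  \int[cp_P V]_w ((Z w)%:E * \int[P n (cp_X V n w, cp_a V n w)]_y (g y)%:E).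
Proof.
move=> Z0 g0 mZ mg.
pose h (z : G * borel E) : \bar R := (Z z.1 * g z.2)%:E.
have h0 z : 0 <= h z by rewrite lee_fin mulr_ge0.
have mh : measurable_fun [set: G * borel E] h.
  apply/measurable_EFinP; apply: measurable_funM.
    exact: (measurableT_comp mZ measurable_fst).
  exact: (measurableT_comp mg measurable_snd).
transitivity (\int[pushforward (cp_P V)
   (fun w => (w, cp_X V n.+1 w) : G * borel E)]_z h z).
  by rewrite ge0_integral_pushforward// preimage_setT.
transitivity (\int[joint]_z h z).
  apply: eq_measure_integral => // A mA _.
  (* Rectangles are stable under intersection, generate the product sigma-algebra and contain the
     whole space, whose mass is finite. *)
  apply: (@measure_unique _ _ _
    [set A `*` B | A in (@measurable _ G) & B in (@measurable _ (borel E))]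
    (fun=> setT)) => //.
  - exact: measurable_prod_measurableType.
  - move=> _ _ [S1 mS1 [B1 mB1 <-]] [S2 mS2 [B2 mB2 <-]].
    rewrite -setXI; exists (S1 `&` S2); first exact: measurableI.
    by exists (B1 `&` B2) => //; exact: measurableI.
  - move=> _; exists setT => //; exists setT => //.
    by apply/seteqP; split.
  - by apply/seteqP; split=> // z _; exists 0%N.
  - by move=> _ [S mS [B mB <-]]; exact: joint_rect.
  - move=> _; apply: (@le_lt_trans _ _ (cp_P V setT)); first exact: lexx.
    by rewrite probability_setT ltry.
rewrite /joint integral_kbind//; apply: eq_integral => w _.
rewrite /kpull /= /kjoint integral_kbind//.
rewrite -ge0_integralZl//; first last.
- by rewrite lee_fin.
- by move=> y _; rewrite lee_fin.
- exact/measurable_EFinP.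
by apply: eq_integral => y _; rewrite integral_dirac// diracT mul1e.
Qed.

End tower.

Local Close Scope ereal_scope.

(** * Certainty equivalents *)

Section bounded_measurable.
Context d (T : measurableType d) (R : realType).
Implicit Types f : T -> R.

Definition bounded_measurable f :=
  measurable_fun [set: T] f /\ exists M : R, forall t, `|f t| <= M.

Lemma bounded_measurable_cst (k : R) : bounded_measurable (cst k).
Proof. by split; [exact: measurable_cst|exists `|k|]. Qed.

Lemma bounded_measurableD f1 f2 : bounded_measurable f1 ->
  bounded_measurable f2 -> bounded_measurable (fun t => f1 t + f2 t).
Proof.
move=> [mf1 [M1 fM1]] [mf2 [M2 fM2]]; split; first exact: measurable_funD.
by exists (M1 + M2) => t; rewrite (le_trans (ler_normD _ _))// lerD.
Qed.

Lemma bounded_measurableDcst f k : bounded_measurable f ->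
  bounded_measurable (fun t => f t + k).
Proof.
by move=> bf; exact: (bounded_measurableD bf (bounded_measurable_cst k)).
Qed.

Lemma bounded_measurable_expR (g : R) f : bounded_measurable f ->
  bounded_measurable (fun t => expR (g * f t)).
Proof.
move=> [mf [M fM]]; split.
  apply: (measurableT_comp (@measurable_expR R)).
  exact: (measurable_funM (measurable_cst _)).
exists (expR (`|g| * M)) => t; rewrite ger0_norm ?expR_ge0// ler_expR.
by rewrite (le_trans (ler_norm _))// normrM ler_wpM2l.
Qed.

Lemma bounded_measurable_integrable (m : {measure set T -> \bar R}) f :
  m setT = 1%E -> bounded_measurable f -> m.-integrable [set: T] (EFin \o f).
Proof. by move=> m1 [mf [M fM]]; exact: integrable_bounded fM. Qed.

Lemma integrable_prob_cst (m : {measure set T -> \bar R}) (k : R) :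
  m setT = 1%E -> m.-integrable [set: T] (EFin \o fun=> k).
Proof.
move=> m1; apply: bounded_measurable_integrable => //.
exact: bounded_measurable_cst.
Qed.

Lemma Rintegral_prob_cst (m : {measure set T -> \bar R}) k : m setT = 1%E ->
  Rintegral m setT (cst k) = k.
Proof. by move=> m1; rewrite Rintegral_cst// m1 mulr1. Qed.

Lemma RintegralDcst (m : {measure set T -> \bar R}) f k : m setT = 1%E ->
  bounded_measurable f ->
  Rintegral m setT (fun t => f t + k) = Rintegral m setT f + k.
Proof.
move=> m1 bf; rewrite RintegralD//.
- by congr (_ + _); exact: Rintegral_prob_cst.
- exact: bounded_measurable_integrable.
- exact: integrable_prob_cst.
Qed.

Lemma Rintegral_EFin (m : {measure set T -> \bar R}) f :
  m setT = 1%E -> bounded_measurable f ->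
  (\int[m]_t (f t)%:E)%E = (Rintegral m setT f)%:E.
Proof.
move=> m1 bf; rewrite fineK//.
exact: (integrable_fin_num measurableT (bounded_measurable_integrable m1 bf)).
Qed.

(** Boundedness of [f] keeps the integrand above a positive constant, so the logarithm in
    [certainty] is taken at a positive number. *)
Lemma Rintegral_expR_gt0 (m : {measure set T -> \bar R}) (g : R) f :
  m setT = 1%E -> bounded_measurable f ->
  0 < Rintegral m setT (fun t => expR (g * f t)).
Proof.
move=> m1 bf; have [_ [M fM]] := bf.
apply: (@lt_le_trans _ _ (expR (- (`|g| * M)))); first exact: expR_gt0.
rewrite -[leLHS](Rintegral_prob_cst (expR (- (`|g| * M))) m1).
apply: le_Rintegral => //.
- exact: integrable_prob_cst.
- exact/bounded_measurable_integrable/bounded_measurable_expR.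
- move=> t _; rewrite ler_expR lerNl (le_trans (ler_norm _))//.
  by rewrite normrN normrM ler_wpM2l.
Qed.

End bounded_measurable.

(* The entropic certainty equivalent; at [g = 0] it is the mean, which is what
   lets both criteria be treated at once. *)
Definition certainty (R : realType) (g : R) d (T : measurableType d)
    (m : {measure set T -> \bar R}) (f : T -> R) : R :=
  if g == 0 then Rintegral m [set: T] f
  else g^-1 * ln (Rintegral m [set: T] (fun t => expR (g * f t))).

Section certainty.
Context d (T : measurableType d) (R : realType) (g : R).
Variable m : {measure set T -> \bar R}.
Hypothesis m1 : m setT = 1%E.
Implicit Types f : T -> R.

(** For negative [g] the order is reversed twice, once inside the exponential and once by the factor
    [g^-1]. *)
Lemma le_certainty f1 f2 : bounded_measurable f1 -> bounded_measurable f2 ->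
  (forall t, f1 t <= f2 t) -> certainty g m f1 <= certainty g m f2.
Proof.
move=> bf1 bf2 f12; rewrite /certainty; case: eqVneq => [_|g0].
  by apply: le_Rintegral => //; exact: bounded_measurable_integrable.
have H f : bounded_measurable f ->
    m.-integrable [set: T] (EFin \o fun t => expR (g * f t)).
  by move=> bf; exact/bounded_measurable_integrable/bounded_measurable_expR.
have pos f (bf : bounded_measurable f) := Rintegral_expR_gt0 g m1 bf.
move: g0; rewrite neq_lt => /orP[lt0|gt0].
  rewrite ler_nM2l; last by rewrite invr_lt0.
  rewrite ler_ln ?posrE; [|exact: pos|exact: pos].
  apply: le_Rintegral; [by []|exact: H|exact: H|] => t _.
  by rewrite ler_expR ler_nM2l.
rewrite ler_pM2l; last by rewrite invr_gt0.
rewrite ler_ln ?posrE; [|exact: pos|exact: pos].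
apply: le_Rintegral; [by []|exact: H|exact: H|] => t _.
by rewrite ler_expR ler_pM2l.
Qed.

Lemma certaintyD f k : bounded_measurable f ->
  certainty g m (fun t => f t + k) = certainty g m f + k.
Proof.
move=> bf; rewrite /certainty; case: eqVneq => [_|g0].
  exact: RintegralDcst.
have -> : (fun t => expR (g * (f t + k))) =
          (fun t => expR (g * k) * expR (g * f t)).
  by apply/funext => t; rewrite -expRD -mulrDr addrC.
rewrite RintegralZl//; last first.
  exact/bounded_measurable_integrable/bounded_measurable_expR.
rewrite lnM ?posrE ?expR_gt0 ?Rintegral_expR_gt0// expRK mulrDr addrC.
by rewrite mulKf.
Qed.

Lemma certainty_cst k : certainty g m (cst k) = k.
Proof.
rewrite /certainty; case: eqVneq => [_|g0]; first exact: Rintegral_prob_cst.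
by rewrite [X in ln X](Rintegral_prob_cst (expR (g * k)) m1) expRK mulKf.
Qed.

Lemma certainty_norm f M : bounded_measurable f -> (forall t, `|f t| <= M) ->
  `|certainty g m f| <= M.
Proof.
move=> bf fM; rewrite ler_norml -[X in X <= _ <= _]certainty_cst.
rewrite -[X in _ <= _ <= X]certainty_cst; apply/andP; split.
- apply: le_certainty => //; first exact: bounded_measurable_cst.
  by move=> t; have := fM t; rewrite ler_norml => /andP[].
- apply: le_certainty => //; first exact: bounded_measurable_cst.
  by move=> t; have := fM t; rewrite ler_norml => /andP[].
Qed.

End certainty.

Section certainty_kernel.
Context d1 d2 (X : measurableType d1) (Y : measurableType d2) (R : realType).
Variable k : R.-pker X ~> Y.

Lemma measurable_Rintegral_kernel (f : Y -> R) : bounded_measurable f ->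
  measurable_fun [set: X] (fun x => Rintegral (k x) setT f).
Proof.
move=> bf; have [mf [M fM]] := bf.
(* The shift makes the integrand nonnegative, where measurability of kernel integrals applies; its
   contribution [M] is subtracted afterwards. *)
pose h y := f y + M.
have bh : bounded_measurable h.
  exact: bounded_measurableDcst.
have k1 x : k x setT = 1%E by exact: prob_kernel.
have -> : (fun x => Rintegral (k x) setT f) =
          (fun x => fine (\int[k x]_y (h y)%:E) - M).
  by apply/funext => x; rewrite Rintegral_EFin//= RintegralDcst// addrK.
apply: measurable_funB; last exact: measurable_cst.
apply: (measurableT_comp (fine_measurable measurableT)).
apply: (@measurable_fun_integral_kernel _ _ X Y R k (measurable_kernel k)).
  by move=> y; rewrite lee_fin -lerBlDr sub0r; have := fM y; rewrite ler_norml => /andP[].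
by apply/measurable_EFinP; case: bh.
Qed.

Lemma bounded_measurable_certainty g (f : Y -> R) : bounded_measurable f ->
  bounded_measurable (fun x => certainty g (k x) f).
Proof.
move=> bf; split; last first.
  have [_ [M fM]] := bf; exists M => x; apply: certainty_norm => //.
  exact: prob_kernel.
rewrite /certainty; case: eqVneq => _; first exact: measurable_Rintegral_kernel.
apply: measurable_funM; first exact: measurable_cst.
apply: (measurableT_comp (@measurable_ln R)).
exact/measurable_Rintegral_kernel/bounded_measurable_expR.
Qed.

End certainty_kernel.

Section certainty_next.
Context (R : realType) (E : completePseudoMetricType R) (U : pseudoPMetricType R).
Variables (P : nat -> R.-pker (borel E * borel U) ~> borel E) (x : E).
Variables (V : control P x) (n : nat).

Local Notation O := (cp_O V).
Local Notation G := (g_sigma_algebraType (cp_F V n)).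
Let PT z : P n z setT = 1%E. Proof. exact: prob_kernel. Qed.
Let VT : cp_P V setT = 1%E. Proof. exact: probability_setT. Qed.

Lemma bounded_measurable_of_history (f : O -> R) :
  bounded_measurable (f : G -> R) -> bounded_measurable f.
Proof. by case=> mf bf; split=> //; exact: (measurable_fun_of_history mf). Qed.

Lemma bounded_measurable_next (f : borel E -> R) : bounded_measurable f ->
  bounded_measurable (fun w : O => f (cp_X V n.+1 w)).
Proof.
move=> [mf [M fM]]; split; last by exists M.
exact: (measurableT_comp mf (@measurable_next _ _ _ _ _ V n)).
Qed.

Lemma bounded_measurable_state_action (f : borel E * borel U -> R) :
  bounded_measurable f ->
  bounded_measurable ((fun w => f (cp_X V n w, cp_a V n w)) : G -> R).
Proof.
move=> [mf [M fM]]; split; last by exists M.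
exact: (measurableT_comp mf (@measurable_state_action _ _ _ _ _ V n)).
Qed.

Lemma Rintegral_next (Z : O -> R) (f : borel E -> R) :
  (forall w, 0 <= Z w) -> (forall y, 0 <= f y) ->
  bounded_measurable (Z : G -> R) -> bounded_measurable f ->
  Rintegral (cp_P V) setT (fun w => Z w * f (cp_X V n.+1 w)) =
  Rintegral (cp_P V) setT
    (fun w => Z w * Rintegral (P n (cp_X V n w, cp_a V n w)) setT f).
Proof.
move=> Z0 f0 [mZ _] bf; rewrite /Rintegral integral_next//; last by case: bf.
congr fine; apply: eq_integral => w _; rewrite EFinM; congr (_ * _)%E.
exact: Rintegral_EFin.
Qed.

(** For [g != 0] the exponential of the sum is a product whose first factor is known at time [n],
    and the conditional integral of the second is the exponential of [g] times its certainty
    equivalent. For [g = 0] linearity separates [S]. *)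
Lemma certainty_next g (S : O -> R) (f : borel E -> R) :
  bounded_measurable (S : G -> R) -> bounded_measurable f ->
  certainty g (cp_P V) (fun w => S w + f (cp_X V n.+1 w)) =
  certainty g (cp_P V)
    (fun w => S w + certainty g (P n (cp_X V n w, cp_a V n w)) f).
Proof.
move=> bS bf; have bSO := bounded_measurable_of_history bS.
rewrite /certainty; case: eqVneq => [_|g0]; last first.
  congr (_ * ln _); transitivity (Rintegral (cp_P V) setT
      (fun w => expR (g * S w) * expR (g * f (cp_X V n.+1 w)))).
    by congr Rintegral; apply/funext => w; rewrite mulrDr expRD.
  rewrite (@Rintegral_next (fun w => expR (g * S w)) (fun y => expR (g * f y)));
    last 4 first.
  - by move=> w; exact: expR_ge0.
  - by move=> w; exact: expR_ge0.
  - exact: bounded_measurable_expR.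
  - exact: bounded_measurable_expR.
  congr Rintegral; apply/funext => w; rewrite mulrDr mulVKf// expRD lnK//.
  by rewrite posrE; exact: Rintegral_expR_gt0.
(* [Rintegral_next] asks for nonnegative functions; adding [M] to [f] meets this, with the weight
   taken to be 1. *)
have [_ [M fM]] := bf.
have bfM : bounded_measurable (fun y => f y + M).
  exact: bounded_measurableDcst.
have bF : bounded_measurable
    (fun w : O => Rintegral (P n (cp_X V n w, cp_a V n w)) setT f).
  have := bounded_measurable_certainty (P n) 0 bf.
  rewrite /certainty eqxx => /bounded_measurable_state_action.
  exact: bounded_measurable_of_history.
rewrite !RintegralD//; try exact: bounded_measurable_integrable.
  2: exact/bounded_measurable_integrable/bounded_measurable_next.
congr (_ + _); apply: (@addIr _ M).
rewrite -!RintegralDcst//; last exact: bounded_measurable_next.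
transitivity (Rintegral (cp_P V) setT
    (fun w => cst 1 w * (f (cp_X V n.+1 w) + M))).
  by congr Rintegral; apply/funext => w; rewrite mul1r.
rewrite (@Rintegral_next (cst 1) (fun y => f y + M))//.
- by congr Rintegral; apply/funext => w; rewrite mul1r RintegralDcst.
- by move=> y; rewrite -lerBlDr sub0r; have := fM y; rewrite ler_norml => /andP[].
- exact: bounded_measurable_cst.
Qed.

End certainty_next.

(** * Topology and measurable selection *)

Section countable_bases.
Context (R : realType).

Lemma separable_second_countable (T : pseudoMetricType R) :
  separable_space T -> @second_countable T.
Proof.
move=> [D [cD dD]].
have r0 n : 0 < (n.+1%:R : R)^-1 by [].
(* Balls of a pseudometric structure need not be open, hence the interiors. *)
exists (\bigcup_n (fun z => (ball z (n.+1%:R : R)^-1)°) @` D); last split.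
- by apply: bigcup_countable => // n _; exact: sub_countable (card_image_le _ _) cD.
- by move=> _ [n _ [z _ <-]]; exact: open_interior.
move=> x V /nbhs_ballP[e /= e0 xeV].
have [N] := @ltr_add_invr R 0 (e / 2) (divr_gt0 e0 (ltr0n _ 2)).
rewrite add0r; set r := (N.+1%:R)^-1 => re.
have rr : 0 < r by exact: r0.
(* A centre within [r / 2] of [x] makes the [r]-ball around it a neighbourhood of [x]; since
   [r < e / 2], this ball stays within [e] of [x]. *)
have [z [/interior_subset xz Dz]] : (ball x (r / 2))° `&` D !=set0.
  apply: dD; last exact: open_interior.
  by exists x; apply: nbhsx_ballx; rewrite divr_gt0.
exists ((ball z r)°).
  split; first by exists N => //; exists z.
  apply: (filterS _ (nbhsx_ballx x (r / 2) _)); last by rewrite divr_gt0.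
  by move=> y xy; rewrite (splitr r); apply: ball_triangle xy; exact: ball_sym.
move=> y /interior_subset zy; apply: xeV; rewrite (splitr e).
apply: (@ball_triangle _ _ z).
- apply: le_ball xz; rewrite (le_trans _ (ltW re))// ler_pdivrMr//.
  by rewrite ler_pMr// ler1n.
- by apply: le_ball zy; exact: ltW.
Qed.

Lemma second_countable_enum (T : topologicalType) : @second_countable T ->
  exists e : nat -> set T, (forall n, open (e n)) /\
    forall x A, nbhs x A -> exists2 n, e n x & e n `<=` A.
Proof.
move=> [B /countable_injP[f injf] [Bo Bx]].
pose e n : set T := xget set0 [set b | B b /\ f b = n].
exists e; split=> [n|x A /Bx[b [/= Bb bx] bA]].
  by rewrite /e; case: xgetP => [b _ [/Bo]//|_]; exact: open0.
suff be : e (f b) = b by exists (f b); rewrite be.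
rewrite /e; case: xgetP => [b' _ [Bb' fb']|/(_ b)]; last by case.
by apply: injf; rewrite ?inE.
Qed.

Lemma second_countable_dense_seq (T : ptopologicalType) : @second_countable T ->
  exists s : nat -> T, forall A, open A -> A !=set0 -> exists k, A (s k).
Proof.
move=> /second_countable_enum[e [_ ex]]; exists (fun n => xget point (e n)).
move=> A oA [x Ax]; have [|n enx enA] := ex x A; first exact: open_nbhs_nbhs.
by exists n; apply: enA; exact: (xgetPex _ (ex_intro _ x enx)).
Qed.

End countable_bases.

Section borel_measurability.
Context (R : realType).

Lemma continuous_borel_measurable (T : ptopologicalType) (f : T -> R) :
  continuous f -> measurable_fun [set: borel T] (f : borel T -> R).
Proof.
move=> /continuousP cf; apply: (measurability _ (RGenOpens.measurableE R)).
move=> _ [_ [a [b ->]] <-]; rewrite setTI; apply: sub_sigma_algebra.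
exact/cf/interval_open.
Qed.

(** With countable bases, an open set is the countable union of the basic open rectangles it
    contains. *)
Lemma open_prod_measurable (S T : ptopologicalType) (A : set (S * T)) :
  @second_countable S -> @second_countable T -> open A ->
  measurable (A : set (borel S * borel T)).
Proof.
move=> /second_countable_enum[e [eo ex]] /second_countable_enum[h [ho hx]] oA.
pose F i j : set (borel S * borel T) :=
  if `[< e i `*` h j `<=` A >] then e i `*` h j else set0.
have -> : A = \bigcup_i \bigcup_j F i j.
  apply/seteqP; split=> [[x y] Axy|z [i _ [j _]]]; last first.
    by rewrite /F; case: asboolP => [H|_ []//]; exact: H.
  have : nbhs (x, y) A by exact: open_nbhs_nbhs.
  move=> [[A1 A2] /= [/ex[i ei eiA] /hx[j hj hjA]] A12].
  exists i => //; exists j => //; rewrite /F; case: asboolP => // -[].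
  by move=> [s t] [/= /eiA ? /hjA ?]; exact: A12.
apply: bigcupT_measurable => i; apply: bigcupT_measurable => j.
rewrite /F; case: asboolP => // _; apply: measurableX.
- exact: sub_sigma_algebra.
- exact: sub_sigma_algebra.
Qed.

Lemma continuous_prod_measurable (S T : ptopologicalType) (f : S * T -> R) :
  @second_countable S -> @second_countable T -> continuous f ->
  measurable_fun [set: borel S * borel T] (f : borel S * borel T -> R).
Proof.
move=> cS cT /continuousP cf.
apply: (measurability _ (RGenOpens.measurableE R)).
move=> _ [_ [a [b ->]] <-]; rewrite setTI.
by apply: open_prod_measurable => //; exact/cf/interval_open.
Qed.

End borel_measurability.

(** Taking the least admissible index gives a choice with countably many values, whose level sets
    are [A k] minus the earlier [A j]. *)
Lemma measurable_first_choice d d' (T : measurableType d) (S : measurableType d')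
    (s : nat -> S) (A : nat -> set T) :
  (forall k, measurable (A k)) -> (forall y, exists k, A k y) ->
  exists2 u : T -> S, measurable_fun [set: T] u &
    forall y, exists2 k, A k y & u y = s k.
Proof.
move=> mA exA.
have exA' y : exists k, `[< A k y >] by have [k ?] := exA y; exists k; exact/asboolP.
pose K y := ex_minn (exA' y).
exists (s \o K); last first.
  by move=> y; exists (K y) => //; rewrite /K; case: ex_minnP => k /asboolP.
have mK k : measurable [set y | K y = k].
  have -> : [set y | K y = k] = A k `\` \bigcup_(j in [set j | (j < k)%N]) A j.
    apply/seteqP; split=> y.
      rewrite /K /=; case: ex_minnP => m /asboolP Am mmin <-; split=> //.
      by move=> [j /= jm /asboolP /mmin]; rewrite leqNgt jm.
    move=> [Ak nA]; rewrite /K /=; case: ex_minnP => m /asboolP Am mmin.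
    apply/eqP; rewrite eqn_leq mmin ?andbT; last exact/asboolP.
    by rewrite leqNgt; apply/negP => mk; apply: nA; exists m.
  by apply: measurableD => //; apply: bigcup_measurable.
move=> _ B mB; rewrite setTI.
have -> : (s \o K) @^-1` B = \bigcup_(k in [set k | B (s k)]) [set y | K y = k].
  apply/seteqP; split=> [y By|y [k /= Bk Kyk]]; first by exists (K y).
  by rewrite /preimage/= Kyk.
exact: bigcup_measurable.
Qed.

(** * The Bellman equation *)

Section limn_einf.
Context (R : realType).
Local Open Scope ereal_scope.

Lemma le_limn_einf (u v : (\bar R)^nat) : (\forall n \near \oo, u n <= v n) ->
  limn_einf u <= limn_einf v.
Proof.
move=> [N _ uv]; rewrite !limn_einf_lim.
apply: lee_lim; [exact: is_cvg_einfs|exact: is_cvg_einfs|].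
exists N => // n /= Nn; apply: le_ereal_inf_tmp => _ [k /= nk <-].
apply: (@le_trans _ _ (u k)); last by apply: uv => /=; exact: leq_trans nk.
by apply: ereal_inf_lbound; exists k.
Qed.

(** For every [e > 0], the extra term [C / n] is at most [e] from some index on. *)
Lemma limn_einf_average_le (a b : nat -> R) (C : R) :
  (forall n, a n <= b n + C)%R ->
  limn_einf (fun n => (n%:R^-1 * a n)%:E) <= limn_einf (fun n => (n%:R^-1 * b n)%:E).
Proof.
move=> abC; apply/lee_addgt0Pr => e e0.
rewrite addeC -limn_einf_shift//; apply: le_limn_einf.
have [N CN] : exists N : nat, (`|C| / e <= N%:R)%R.
  by exists (Num.bound (`|C| / e)); rewrite ltW// archi_boundP// divr_ge0// ltW.
(* Starting at [N.+1] also keeps the divisor [n] positive. *)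
exists N.+1 => // n /= Nn; rewrite -EFinD lee_fin.
have n0 : (0 < n%:R :> R)%R by rewrite ltr0n (leq_trans _ Nn).
rewrite mulrC ler_pdivrMr// mulrDl mulrAC mulVf ?gt_eqF// mul1r.
rewrite (le_trans (abC n))// addrC lerD2r (le_trans (ler_norm C))//.
rewrite -ler_pdivrMl// mulrC (le_trans CN)// ler_nat; exact: ltnW.
Qed.

End limn_einf.

Lemma sum_half_le (R : realType) n : \sum_(i < n) (2^-1 : R) ^+ i <= 2.
Proof.
have -> : \sum_(i < n) (2^-1 : R) ^+ i = 2 - 2 * (2^-1) ^+ n.
  elim: n => [|n IH]; first by rewrite big_ord0 expr0 mulr1 subrr.
  rewrite big_ord_recr /= IH exprS mulrA mulfV ?pnatr_eq0// mul1r.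
  by rewrite mulr_natl mulr2n opprD addrA subrK.
by rewrite lerBlDr lerDl mulr_ge0// exprn_ge0// invr_ge0.
Qed.

Section bellman.
Context (R : realType) (E : completePseudoMetricType R) (U : pseudoPMetricType R).
Hypothesis cE : @second_countable E.
Hypothesis cU : @second_countable U.
Variables (P : nat -> R.-pker (borel E * borel U) ~> borel E).
Hypothesis hP : controlled_feller P.
Variables (c : nat -> E * U -> R).
Hypothesis hc : forall n, bcont (c n).
Variables (g : R) (w : nat -> E -> R) (lam : nat -> R) (M : R).
Hypothesis hw : forall n, bcont (w n).
Hypothesis wM : forall n y, `|w n y| <= M.

Definition bellman n y a : R :=
  c n (y, a) - lam n + certainty g (P n (y, a)) (w n.+1).

Hypothesis bellmanE : forall n y,
  (w n y)%:E = ereal_sup [set (bellman n y a)%:E | a in [set: U]].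

Definition average (x : E) (V : control P x) : \bar R :=
  limn_einf (fun n => (n%:R^-1 * certainty g (cp_P V) (@cost_sum _ _ _ _ c _ V n))%:E).

Let bw n : bounded_measurable (w n : borel E -> R).
Proof. by case: (hw n) => cw bw; split=> //; exact: continuous_borel_measurable. Qed.

Let bc n : bounded_measurable (c n : borel E * borel U -> R).
Proof. by case: (hc n) => cc bc; split=> //; exact: continuous_prod_measurable. Qed.

Lemma le_bellman n y a : bellman n y a <= w n y.
Proof. by rewrite -lee_fin bellmanE; apply: ereal_sup_ubound; exists a. Qed.

(** For [g != 0] the Feller property is used on [expR (g * w n.+1 y)], again bounded and continuous,
    and the logarithm is continuous at its positive integral. *)
Lemma continuous_certainty n :
  continuous (fun z : E * U => certainty g (P n z) (w n.+1)).
Proof.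
rewrite /certainty; case: eqVneq => [_|g0]; first exact: hP.
have [cw [K wK]] := hw n.+1.
have bce : bcont (fun y => expR (g * w n.+1 y)).
  split; last by exact: (bounded_measurable_expR g (bw n.+1)).2.
  move=> y; apply: (@continuous_comp _ _ _ (fun y => g * w n.+1 y)).
    by apply: cvgM; [exact: cvg_cst|exact: cw].
  exact: continuous_expR.
pose F (z : E * U) :=
  Rintegral (P n z) [set: borel E] (fun y => expR (g * w n.+1 y)).
move=> z; apply: cvgM; first exact: cvg_cst.
have : {for z, continuous (@ln R \o F)}.
  apply: continuous_comp; first exact: hP.
  by apply: continuous_ln; apply: Rintegral_expR_gt0 => //; exact: prob_kernel.
exact.
Qed.

Lemma continuous_bellman n : continuous (fun z : E * U => bellman n z.1 z.2).
Proof.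
move=> z; rewrite /bellman.
have -> : (fun z : E * U => c n (z.1, z.2) - lam n +
    certainty g (P n (z.1, z.2)) (w n.+1)) =
  (fun z : E * U => c n z - lam n + certainty g (P n z) (w n.+1)).
  by apply/funext => -[].
apply: cvgD; last exact: continuous_certainty.
apply: cvgB; last exact: cvg_cst.
by case: (hc n) => + _; apply.
Qed.

(** * Telescoping along an arbitrary control *)

Section control.
Variables (x : E) (V : control P x).

Local Notation hist n := (g_sigma_algebraType (cp_F V n)).
Local Notation S n := (@cost_sum _ _ _ _ c _ V n).

Let VT : cp_P V setT = 1%E. Proof. exact: probability_setT. Qed.

Let cost_sumS n v : S n.+1 v = S n v + c n (cp_X V n v, cp_a V n v).
Proof. by rewrite /cost_sum big_ord_recr. Qed.

Let bounded_measurable_incr n (f : cp_O V -> R) :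
  bounded_measurable (f : hist n -> R) -> bounded_measurable (f : hist n.+1 -> R).
Proof.
move=> [mf bf]; split=> //; apply: measurable_fun_history => B mB.
apply: cp_F_incr; rewrite -measurable_history -[X in measurable X]setTI.
exact: mf.
Qed.

Let bounded_cost n : bounded_measurable
  ((fun v => c n (cp_X V n v, cp_a V n v)) : hist n -> R).
Proof. exact: bounded_measurable_state_action. Qed.

Lemma bounded_cost_sum n : bounded_measurable (S n : hist n -> R).
Proof.
elim: n => [|n IH].
  have -> : S 0 = cst 0 by apply/funext => v; rewrite /cost_sum big_ord0.
  exact: bounded_measurable_cst.
apply: bounded_measurable_incr.
have -> : S n.+1 = fun v => S n v + c n (cp_X V n v, cp_a V n v).
  by apply/funext => v; exact: cost_sumS.
exact: (bounded_measurableD IH (bounded_cost n)).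
Qed.

Let bounded_w n : bounded_measurable ((fun v => w n (cp_X V n v)) : hist n -> R).
Proof.
apply: (@bounded_measurable_state_action _ _ _ _ _ V n (fun z => w n z.1)).
have [mw [K wK]] := bw n; split; last by exists K.
exact: (measurableT_comp mw measurable_fst).
Qed.

(** The telescoping quantity: cost so far plus the potential of the current state. *)
Let value n := certainty g (cp_P V) (fun v => S n v + w n (cp_X V n v)).

Let bounded_bellman n :
  bounded_measurable ((fun v => bellman n (cp_X V n v) (cp_a V n v)) : hist n -> R).
Proof.
apply: (@bounded_measurable_state_action _ _ _ _ _ V n
  (fun z => bellman n z.1 z.2)).
apply: (@bounded_measurableD _ _ _ (fun z : borel E * borel U => c n (z.1, z.2) - lam n)
  (fun z => certainty g (P n (z.1, z.2)) (w n.+1))).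
  apply: bounded_measurableD; last exact: bounded_measurable_cst.
  have -> : (fun z : borel E * borel U => c n (z.1, z.2)) = c n.
    by apply/funext => -[].
  exact: bc.
have -> : (fun z : borel E * borel U => certainty g (P n (z.1, z.2)) (w n.+1)) =
    (fun z => certainty g (P n z) (w n.+1)).
  by apply/funext => -[].
exact: bounded_measurable_certainty.
Qed.

Let bounded_pair n (f : cp_O V -> R) : bounded_measurable (f : hist n -> R) ->
  bounded_measurable (fun v => S n v + f v).
Proof.
move=> bf; apply: (@bounded_measurable_of_history _ _ _ _ _ V n).
exact: (bounded_measurableD (bounded_cost_sum n) bf).
Qed.

(** The cost up to and including time [n] involves only states and actions known at time [n], so it
    can be held fixed when conditioning on [cp_F V n]. *)
Let bounded_cost_sumS n : bounded_measurable (S n.+1 : hist n -> R).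
Proof.
have -> : S n.+1 = fun v => S n v + c n (cp_X V n v, cp_a V n v).
  by apply/funext => v; exact: cost_sumS.
exact: (bounded_measurableD (bounded_cost_sum n) (bounded_cost n)).
Qed.

(** Conditioning at time [n] replaces the next potential by its certainty equivalent; together with
    the cost of time [n], this is the Bellman expression plus [lam n]. *)
Let valueS n : value n.+1 = certainty g (cp_P V)
  (fun v => S n v + bellman n (cp_X V n v) (cp_a V n v)) + lam n.
Proof.
rewrite -(certaintyD g VT (lam n) (bounded_pair (bounded_bellman n))).
rewrite /value (certainty_next g (bounded_cost_sumS n) (bw n.+1)).
congr certainty; apply/funext => v; rewrite cost_sumS /bellman.
by rewrite -!addrA; congr (_ + (_ + _)); rewrite addrCA addNr addr0.
Qed.

Let value0 : value 0 = w 0 x.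
Proof.
rewrite -[RHS](certainty_cst g VT); congr certainty; apply/funext => v.
by rewrite /cost_sum big_ord0 add0r cp_X0.
Qed.

Let value_cost n : `|value n - certainty g (cp_P V) (S n)| <= M.
Proof.
have bS : bounded_measurable (S n).
  exact: bounded_measurable_of_history (bounded_cost_sum n).
have wMn v : - M <= w n (cp_X V n v) <= M by rewrite -ler_norml.
have lo : certainty g (cp_P V) (S n) + - M <= value n.
  rewrite -(certaintyD g VT (- M) bS); apply: (le_certainty g VT).
  - exact: bounded_measurableDcst.
  - exact: bounded_pair.
  - by move=> v; rewrite lerD2l; case/andP: (wMn v).
have up : value n <= certainty g (cp_P V) (S n) + M.
  rewrite -(certaintyD g VT M bS); apply: (le_certainty g VT).
  - exact: bounded_pair.
  - exact: bounded_measurableDcst.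
  - by move=> v; rewrite lerD2l; case/andP: (wMn v).
by rewrite ler_norml; apply/andP; split; lra.
Qed.

(** Since [bellman] never exceeds [w], each step raises [value] by at most [lam n]. One [M] pays for
    the initial potential [w 0 x], the other for the terminal one. *)
Lemma certainty_cost_le n :
  certainty g (cp_P V) (S n) <= \sum_(i < n) lam i + (M + M).
Proof.
have H : value n <= \sum_(i < n) lam i + w 0 x.
  elim: n => [|n IH]; first by rewrite big_ord0 add0r value0.
  rewrite valueS big_ord_recr /=.
  suff h : certainty g (cp_P V)
      (fun v => S n v + bellman n (cp_X V n v) (cp_a V n v)) <= value n by lra.
  apply: (le_certainty g VT); [exact: bounded_pair|exact: bounded_pair|] => v.
  by rewrite lerD2l le_bellman.
have := value_cost n; rewrite ler_norml => /andP[h _].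
have := wM 0 x; rewrite ler_norml => /andP[_ w0].
by lra.
Qed.

(** The reverse telescoping: each step raises [value] by at least [lam n - eps n]. *)
Lemma le_certainty_cost (eps : nat -> R) n :
  (forall n v, w n (cp_X V n v) - eps n <= bellman n (cp_X V n v) (cp_a V n v)) ->
  \sum_(i < n) lam i <= certainty g (cp_P V) (S n) + (M + M + \sum_(i < n) eps i).
Proof.
move=> heps.
have H : \sum_(i < n) lam i + w 0 x <= value n + \sum_(i < n) eps i.
  elim: n => [|n IH]; first by rewrite !big_ord0 add0r addr0 value0.
  rewrite valueS !big_ord_recr /= addrAC [leRHS]addrAC lerD2r.
  suff h : value n - eps n <= certainty g (cp_P V)
      (fun v => S n v + bellman n (cp_X V n v) (cp_a V n v)) by lra.
  rewrite -(certaintyD g VT _ (bounded_pair (bounded_w n))).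
  apply: (le_certainty g VT); [|exact: bounded_pair|].
  - exact/bounded_measurableDcst/bounded_pair.
  - by move=> v; rewrite -addrA lerD2l.
have := value_cost n; rewrite ler_norml => /andP[_ h].
have := wM 0 x; rewrite ler_norml => /andP[w0 _].
by lra.
Qed.

End control.
Local Notation mean_lam :=
  (limn_einf (fun n => (n%:R^-1 * \sum_(i < n) lam i)%:E)).

Lemma average_le x (V : control P x) : (average V <= mean_lam)%E.
Proof. exact: limn_einf_average_le (certainty_cost_le V). Qed.

Lemma average_ge x (V : control P x) (eps : nat -> R) (C : R) :
  (forall n v, w n (cp_X V n v) - eps n <= bellman n (cp_X V n v) (cp_a V n v)) ->
  (forall n, \sum_(i < n) eps i <= C) -> (mean_lam <= average V)%E.
Proof.
move=> heps epsC; apply: (@limn_einf_average_le _ _ _ (M + M + C)) => n.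
by rewrite (le_trans (le_certainty_cost n heps))// lerD2l lerD2l.
Qed.

Let continuous_bellman_state n a : continuous (fun y : E => bellman n y a - w n y).
Proof.
move=> y; apply: cvgB; last by case: (hw n) => + _; apply.
have : {for y, continuous ((fun z : E * U => bellman n z.1 z.2) \o
    (fun y' : E => (y', a)))}.
  apply: continuous_comp; last exact: continuous_bellman.
  by apply: cvg_pair; [exact: cvg_id|exact: cvg_cst].
exact.
Qed.

Let continuous_bellman_action n y : continuous (fun a : U => bellman n y a).
Proof.
move=> a; have : {for a, continuous ((fun z : E * U => bellman n z.1 z.2) \o
    (fun a' : U => (y, a')))}.
  apply: continuous_comp; last exact: continuous_bellman.
  by apply: cvg_pair; [exact: cvg_cst|exact: cvg_id].
exact.
Qed.

(** The strict inequality does double duty: for fixed [y] it cuts out a nonempty open set of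
    actions, met by the dense sequence; for a fixed action it cuts out an open, hence Borel, set of
    states. *)
Lemma near_selector n (e : R) : 0 < e -> exists2 u : borel E -> borel U,
  measurable_fun [set: borel E] u & forall y, w n y - e < bellman n y (u y).
Proof.
move=> e0; have [s hs] := second_countable_dense_seq cU.
pose A k : set (borel E) := [set y | w n y - e < bellman n y (s k)].
have [||u mu uA] := @measurable_first_choice _ _ (borel E) (borel U) s A.
- move=> k; apply: sub_sigma_algebra.
  have -> : A k = (fun y => bellman n y (s k) - w n y) @^-1` [set r | - e < r].
    apply/seteqP; split=> y; rewrite /A /preimage /=; lra.
  by have /continuousP cf := @continuous_bellman_state n (s k); exact/cf/open_gt.
- move=> y.
  have [_ [a _ <-]] : exists2 r : \bar R,
      [set (bellman n y a)%:E | a in [set: U]] r & ((w n y - e)%:E < r)%E.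
    by apply: ereal_sup_gt; rewrite -bellmanE lte_fin ltrBlDr ltrDl.
  rewrite lte_fin => ha.
  have [||k hk] := hs ((fun a => bellman n y a) @^-1` [set r | w n y - e < r]).
  + by have /continuousP cf := @continuous_bellman_action n y; exact/cf/open_gt.
  + by exists a.
  + by exists k.
by exists u => // y; have [k Aky ->] := uA y.
Qed.

Lemma exists_optimal_control x : exists V : control P x, (mean_lam <= average V)%E.
Proof.
have /choice[u hu] n : exists u : borel E -> borel U,
    measurable_fun [set: borel E] u /\
    forall y, w n y - 2^-1 ^+ n < bellman n y (u y).
  have e0 : 0 < (2^-1 : R) ^+ n by rewrite exprn_gt0// invr_gt0.
  by have [u mu hu] := near_selector n e0; exists u.
have [V mV] := @markov_control_exists R E U P x u (fun n => (hu n).1).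
(* The errors [2^-1 ^+ n] form a geometric series with partial sums at most 2, whatever the
   horizon. *)
exists V; apply: (@average_ge _ V (fun n => 2^-1 ^+ n) 2) => [n v|n].
  by rewrite mV ltW//; exact: (hu n).2.
exact: sum_half_le.
Qed.

Lemma sup_average x :
  ereal_sup [set j | exists V : control P x, j = average V] = mean_lam.
Proof.
apply/eqP; rewrite eq_le; apply/andP; split.
  by apply: ge_ereal_sup => _ [V ->]; exact: average_le.
have [V hV] := exists_optimal_control x; apply: (le_trans hV).
by apply: ereal_sup_ubound; exists V.
Qed.

(** An exact maximizer is the case of zero errors in [average_ge]. *)
Lemma average_selector x (u : nat -> E -> U) (V : control P x) :
  (forall n y, bellman n y (u n y) = w n y) -> markov_control u V ->
  average V = mean_lam.
Proof.
move=> hu mV; apply/eqP; rewrite eq_le average_le /=.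
apply: (@average_ge _ V (fun=> 0) 0) => [n v|n]; last by rewrite big1.
by rewrite mV hu subr0.
Qed.

End bellman.

(** A function vanishing at one point is bounded by its span; at [xbar] this turns the uniform span
    bound into the constant [M] of the telescoping. *)
Lemma norm_le_span (R : realType) (T : Type) (v : T -> R) (t0 : T) (M : R) :
  (span_norm v <= M%:E)%E -> v t0 = 0 -> forall t, `|v t| <= M.
Proof.
move=> vM v0 t; have H a b : v a - v b <= M.
  by rewrite -lee_fin (le_trans _ vM)//; apply: ereal_sup_ubound; exists a => //; exists b.
rewrite ler_norml; have := H t t0; have := H t0 t; rewrite v0.
by move=> h1 h2; apply/andP; split; lra.
Qed.

(** * Both criteria as averages of certainty equivalents *)

Section functionals.
Context (R : realType) (E : completePseudoMetricType R) (U : pseudoPMetricType R).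
Variables (P : nat -> R.-pker (borel E * borel U) ~> borel E).
Variables (c : nat -> E * U -> R) (w : nat -> E -> R) (lam : nat -> R).
Hypothesis hw : forall n, bcont (w n).

Lemma rhs_bellman n y a : rhs P c w lam n y a = (bellman P c 0 w lam n y a)%:E.
Proof.
rewrite /rhs /bellman /certainty eqxx Rintegral_EFin ?EFinD//.
  exact: prob_kernel.
case: (hw n.+1) => cw bw; split=> //; exact: continuous_borel_measurable.
Qed.

Lemma rhs_r_bellman g n y a : g != 0 ->
  rhs_r P c g w lam n y a = (bellman P c g w lam n y a)%:E.
Proof. by move=> g0; rewrite /rhs_r /bellman /certainty (negbTE g0). Qed.

Lemma Jr_average g x (V : control P x) : g != 0 -> Jr c V g = average c g V.
Proof.
move=> g0; congr limn_einf; apply/funext => n.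
by rewrite /certainty (negbTE g0) invfM mulrA.
Qed.

(** The cost sum is bounded and measurable, so its extended-real integral is finite and equals the
    real-valued one. *)
Lemma J_average x (V : control P x) :
  @second_countable E -> @second_countable U -> (forall n, bcont (c n)) ->
  J c V = average c 0 V.
Proof.
move=> cE cU hc; congr limn_einf; apply/funext => n.
rewrite /certainty eqxx EFinM Rintegral_EFin//; first exact: probability_setT.
apply: (@bounded_measurable_of_history _ _ _ _ _ V n).
exact: bounded_cost_sum.
Qed.

End functionals.

Theorem theorem1 (R : realType)
  (E : completePseudoMetricType R) (hE : hausdorff_space E)
  (sE : separable_space E)
  (U : pseudoPMetricType R) (hU : hausdorff_space U) (cU : compact [set: U])
  (P : nat -> R.-pker (borel E * borel U) ~> borel E)
  (hP : controlled_feller P)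
  (c : nat -> E * U -> R) (hc : forall n, bcont (c n))
  (xbar : E) :
  (* (a) risk-neutral average cost *)
  (forall (w : nat -> E -> R) (lam : nat -> R),
    (forall n, bcont (w n)) ->
    (forall n x, (w n x)%:E = ereal_sup [set rhs P c w lam n x a | a in [set: U]]) ->
    (exists M : R, forall n, (span_norm (w n) <= M%:E)%E) ->
    (forall n, w n xbar = 0) ->
    forall x : E,
      supJ P c x =
        limn_einf (fun n => (n%:R^-1 * \sum_(i < n) lam i)%:E) /\
      forall u : nat -> E -> U,
        (forall n, measurable_fun [set: borel E] (u n : borel E -> borel U)) ->
        (forall n x', rhs P c w lam n x' (u n x') =
                      ereal_sup [set rhs P c w lam n x' a | a in [set: U]]) ->
        (exists V : control P x, markov_control u V) /\
        (forall V : control P x, markov_control u V ->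
           J c V = supJ P c x))
  /\
  (* (b) risk-sensitive *)
  (forall gamma : R, gamma != 0 ->
   forall (w : nat -> E -> R) (lam : nat -> R),
    (forall n, bcont (w n)) ->
    (forall n x, (w n x)%:E =
                 ereal_sup [set rhs_r P c gamma w lam n x a | a in [set: U]]) ->
    (exists M : R, forall n, (span_norm (w n) <= M%:E)%E) ->
    (forall n, w n xbar = 0) ->
    forall x : E,
      supJr P c x gamma =
        limn_einf (fun n => (n%:R^-1 * \sum_(i < n) lam i)%:E) /\
      forall u : nat -> E -> U,
        (forall n, measurable_fun [set: borel E] (u n : borel E -> borel U)) ->
        (forall n x', rhs_r P c gamma w lam n x' (u n x') =
                      ereal_sup [set rhs_r P c gamma w lam n x' a | a in [set: U]]) ->
        (exists V : control P x, markov_control u V) /\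
        (forall V : control P x, markov_control u V ->
           Jr c V gamma = supJr P c x gamma)).
Proof.
have cE := separable_second_countable sE.
have cUU := compact_second_countable cU.
split=> [w lam hw hb [M hM] w0 x|g g0 w lam hw hb [M hM] w0 x].
  have wM n := norm_le_span (hM n) (w0 n).
  have hb' n y : (w n y)%:E =
      ereal_sup [set (bellman P c 0 w lam n y a)%:E | a in [set: U]].
    by rewrite hb; under eq_imagel do rewrite rhs_bellman//.
  (* Rewriting the supremum throughout reduces optimality of a selector to the equality of its
     average with the same lower limit. *)
  have -> : supJ P c x = limn_einf (fun n => (n%:R^-1 * \sum_(i < n) lam i)%:E).
    rewrite -(@sup_average _ _ _ cE cUU P hP c hc 0 w lam M hw wM hb' x).
    by congr ereal_sup; apply/seteqP; split=> j [V ->]; exists V;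
      rewrite J_average.
  split=> // u mu hu; split=> [|V mV]; first exact: markov_control_exists.
  rewrite J_average//.
  apply: (@average_selector _ _ _ cE cUU P c hc 0 w lam M hw wM hb' x u V) => //.
  by move=> n y; apply: EFin_inj; rewrite -rhs_bellman// hu -hb.
have wM n := norm_le_span (hM n) (w0 n).
have hb' n y : (w n y)%:E =
    ereal_sup [set (bellman P c g w lam n y a)%:E | a in [set: U]].
  by rewrite hb; under eq_imagel do rewrite rhs_r_bellman//.
have -> : supJr P c x g = limn_einf (fun n => (n%:R^-1 * \sum_(i < n) lam i)%:E).
  rewrite -(@sup_average _ _ _ cE cUU P hP c hc g w lam M hw wM hb' x).
  by congr ereal_sup; apply/seteqP; split=> j [V ->]; exists V;
    rewrite Jr_average.
split=> // u mu hu; split=> [|V mV]; first exact: markov_control_exists.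
rewrite Jr_average//.
apply: (@average_selector _ _ _ cE cUU P c hc g w lam M hw wM hb' x u V) => //.
by move=> n y; apply: EFin_inj; rewrite -rhs_r_bellman// hu -hb.
Qed.
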